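(* For every precontinuous set functor $F\colon\mathbf{Set}\to\mathbf{Set}$ the terminal-coalgebra chain converges in $\delta$ steps for some ordinal $\delta\geq\omega$ (so that $\nu F=F^\delta 1$), and the connecting map $$v_{\delta,\omega}\colon \nu F\to F^\omega 1$$ is monic.
   Context: A set functor is an endofunctor of $\mathbf{Set}$. A prelimit of an $\omega^{\mathrm{op}}$-chain is a cone of it which is collectively monic, i.e., such that every other cone has at most one factorization through it. A set functor is precontinuous if it preserves nonempty prelimits of $\omega^{\mathrm{op}}$-chains, i.e., it takes every prelimit with nonempty domain of an $\omega^{\mathrm{op}}$-chain to a prelimit of the image chain. The terminal-coalgebra chain of $F$ consists of the objects $F^i1$ ($i$ an ordinal) and connecting morphisms $v_{i,j}\colon F^i1\to F^j1$ ($i\geq j$), defined by transfinite recursion: $F^01=1$ (a singleton set), $F^{i+1}1=F(F^i1)$, and $F^j1=\lim_{i<j}F^i1$ for limit ordinals $j$; $v_{1,0}\colon F1\to1$ is the unique map, $v_{i+1,j+1}=Fv_{i,j}$, and for limit ordinals $j$ the morphisms $v_{j,i}$ ($i<j$) form the limit cone. The chain converges at (in) $\delta$ (steps) if $v_{\delta+1,\delta}$ is invertible; then $F^\delta1$ with the structure $v_{\delta+1,\delta}^{-1}\colon F^\delta 1\to F(F^\delta1)$ is the terminal coalgebra $\nu F$. *)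

(* Defs.v *)
From mathcomp Require Import all_boot.
From mathcomp Require Import boolp.

Set Implicit Arguments.
Unset Strict Implicit.
Unset Printing Implicit Defensive.

(* A single fixed universe, so that iterating an endofunctor of the category
   of types and functions raises no universe constraint. *)
Definition SET := Type.

Record set_functor := SetFunctor {
  fobj :> SET -> SET;
  fmap : forall A B : SET, (A -> B) -> fobj A -> fobj B;
  fmap_id : forall A : SET, fmap (@id A) = id;
  fmap_comp : forall (A B C : SET) (g : B -> C) (f : A -> B),
    fmap (g \o f) = fmap g \o fmap f
}.
Arguments fmap F {A B} : rename.

Definition monic (A B : SET) (f : A -> B) : Prop :=
  forall (C : SET) (g h : C -> A), f \o g = f \o h -> g = h.

(** * Prelimits of omega^op-chains and precontinuity *)

Record opchain := OpChain {
  chain_obj :> nat -> SET;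
  chain_map : forall n, chain_obj n.+1 -> chain_obj n
}.
Arguments chain_map : clear implicits.

Record cone (D : opchain) := Cone {
  apex : SET;
  leg : forall n, apex -> D n;
  leg_comm : forall n, chain_map D n \o @leg n.+1 = @leg n
}.
Arguments leg {D} K n : rename.

Definition factorizes (D : opchain) (K K' : cone D) (h : apex K' -> apex K)
    : Prop :=
  forall n, leg K n \o h = leg K' n.

Definition is_prelimit (D : opchain) (K : cone D) : Prop :=
  forall (K' : cone D) (h h' : apex K' -> apex K),
    factorizes h -> factorizes h' -> h = h'.

Definition map_opchain (F : set_functor) (D : opchain) : opchain :=
  OpChain (fun n => fmap F (chain_map D n)).

Lemma map_leg_comm (F : set_functor) (D : opchain) (K : cone D) n :
  chain_map (map_opchain F D) n \o fmap F (leg K n.+1)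
  = fmap F (leg K n).
Proof. by rewrite /= -fmap_comp leg_comm. Qed.

Definition map_cone (F : set_functor) (D : opchain) (K : cone D) :
  cone (map_opchain F D) := Cone (map_leg_comm F K).

Definition precontinuous (F : set_functor) : Prop :=
  forall (D : opchain) (K : cone D),
    inhabited (apex K) -> is_prelimit K -> is_prelimit (map_cone F K).

(** * Ordinals *)

(* The tree [osup A f] denotes the least ordinal strictly above all [f a].
   Distinct trees may denote the same ordinal: [ole] is the (total,
   well-founded) preorder by ordinal value, and i, j denote the same ordinal
   iff [i <=o j] and [j <=o i].  Every well-ordered [A : SET] embeds
   (lemma [orank_lt]), so every small ordinal is denoted. *)
Inductive ord : Type := osup (A : SET) (f : A -> ord).

Fixpoint ole (i j : ord) {struct i} : Prop :=
  match i, j with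
  | osup A f, osup B g => forall a : A, exists b : B, ole (f a) (g b)
  end.

Definition olt (i j : ord) : Prop :=
  match j with osup B g => exists b : B, ole i (g b) end.

Notation "i <=o j" := (ole i j) (at level 70, no associativity).
Notation "i <o j" := (olt i j) (at level 70, no associativity).

Definition ozero : ord := osup (fun x : Empty_set => match x with end).
Definition osucc (i : ord) : ord := osup (fun _ : unit => i).
Definition ofin (n : nat) : ord := iter n osucc ozero.
Definition omega : ord := osup ofin.

Definition olimit (j : ord) : Prop :=
  ozero <o j /\ forall i, i <o j -> osucc i <o j.

Lemma ole_refl i : i <=o i.
Proof. by elim: i => A f IH a; exists a; apply: IH. Qed.

Lemma ole_trans i j k : i <=o j -> j <=o k -> i <=o k.
Proof.
elim: i j k => A f IH [B g] [C h] ij jk a.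
have [b ab] := ij a; have [c bc] := jk b.
by exists c; apply: IH ab bc.
Qed.

Lemma ole_osup (A : SET) (f : A -> ord) a : f a <=o osup f.
Proof.
suff H i : match i with osup A f => forall a, f a <=o osup f end.
  exact: (H (osup f)).
elim: i => {}A {}f IH {}a.
have := IH a; case E: (f a) => [C k] H c; exists a; rewrite E; exact: H.
Qed.

Lemma olt_le i j : i <o j -> i <=o j.
Proof.
case: j => B g [b ib]; exact: ole_trans ib (ole_osup g b).
Qed.

Lemma olt_osup (A : SET) (f : A -> ord) a : f a <o osup f.
Proof. by exists a; apply: ole_refl. Qed.

Lemma olt_osucc i : i <o osucc i.
Proof. exact: (@olt_osup unit (fun=> i) tt). Qed.

Lemma ole_osucc i : i <=o osucc i.
Proof. exact/olt_le/olt_osucc. Qed.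

Lemma olt_succ i j : i <o j <-> osucc i <=o j.
Proof. by case: j => B g; split=> [ij _ //|/(_ tt)]. Qed.

Lemma ole_succ2 i j : j <=o i -> osucc j <=o osucc i.
Proof. by move=> ji _; exists tt. Qed.

Lemma ole_lt_trans i j k : i <=o j -> j <o k -> i <o k.
Proof. by case: k => C h ij [c jc]; exists c; apply: ole_trans jc. Qed.

Lemma olt_le_trans i j k : i <o j -> j <=o k -> i <o k.
Proof. by move=> /olt_succ ij jk; apply/olt_succ/(ole_trans ij jk). Qed.

Lemma olt_wf : well_founded olt.
Proof.
have H i j : j <=o i -> Acc olt j.
  elim: i j => A f IH j ji; constructor=> k kj.
  by have [a ka] : k <o osup f := olt_le_trans kj ji; apply: IH ka.
by move=> i; apply: H (ole_refl i).
Qed.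

Lemma olt_irr i : ~ i <o i.
Proof. by elim/(well_founded_ind olt_wf): i => i IH ii; apply: (IH i). Qed.

Lemma ole_total i j : i <=o j \/ j <o i.
Proof.
elim: i j => A f IH [B g].
have [ij|/existsNP[a nab]] := EM (osup f <=o osup g); [by left|right].
exists a; case E: (f a) => [C h] b.
have [ab|] := IH a (g b); first by case: nab; exists b.
by rewrite E.
Qed.

Definition orank (A : SET) (R : A -> A -> Prop) (wf : well_founded R) : A -> ord :=
  Fix wf (fun=> ord)
    (fun x rank => osup (fun y : {y | R y x} => rank (sval y) (svalP y))).

Lemma orank_lt (A : SET) (R : A -> A -> Prop) (wf : well_founded R)
    (tot : forall x y, [\/ R x y, x = y | R y x]) x y :
  R x y <-> orank wf x <o orank wf y.
Proof.
have lt u v : R u v -> orank wf u <o orank wf v.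
  move=> uv; rewrite [orank wf v]/orank Fix_eq; last first.
    by move=> z f g fg; congr osup; apply: funext => w; rewrite fg.
  by exists (exist _ u uv); apply: ole_refl.
split; first exact: lt.
case: (tot x y) => [//|-> /olt_irr //|/lt/olt_le yx xy].
by case: (olt_irr (olt_le_trans xy yx)).
Qed.

(** * The terminal-coalgebra chain *)

(* The chain is determined up to unique isomorphism by transfinite recursion.
   [chain_step] is the identification of F^(i+1)1 with F(F^i 1); the limit
   clause is the universal property of the cone (v_(j,i))_(i<j).  Maps between
   trees of equal ordinal value are isomorphisms, by functoriality. *)
Record terminal_chain (F : set_functor) := TerminalChain {
  stage :> ord -> SET;
  conn : forall i j : ord, j <=o i -> stage i -> stage j;
  conn_refl : forall i (h : i <=o i), conn h = id;
  conn_trans : forall i j k (ij : j <=o i) (jk : k <=o j) (ik : k <=o i),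
    conn jk \o conn ij = conn ik;
  stage_zero : exists x : stage ozero, forall y, y = x;
  chain_step : forall i, stage (osucc i) -> F (stage i);
  chain_step_iso : forall i, bijective (@chain_step i);
  conn_succ : forall i j (ji : j <=o i) (ji' : osucc j <=o osucc i),
    @chain_step j \o conn ji' = fmap F (conn ji) \o @chain_step i;
  stage_limit : forall j, olimit j ->
    forall (B : SET) (q : forall i, i <o j -> B -> stage i),
      (forall i i' (ij : i <o j) (i'j : i' <o j) (ii' : i' <=o i),
         conn ii' \o q i ij = q i' i'j) ->
      exists! u : B -> stage j,
        forall i (ij : i <o j), conn (olt_le ij) \o u = q i ij
}.

Arguments conn {F} V {i j} : rename.

Definition converges_in (F : set_functor) (V : terminal_chain F) (d : ord)
    : Prop :=
  bijective (conn V (ole_osucc d)).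

Definition is_terminal_coalgebra (F : set_functor) (T : SET) (t : T -> F T)
    : Prop :=
  forall (A : SET) (a : A -> F A),
    exists! h : A -> T, t \o h = fmap F h \o a.

(** * Existence of the chain *)

(* Uniformly in i, F^i 1 is realized as the limit of F (F^k 1) over k < i. *)

(* [node X F kids p] records a candidate X for F^i 1 together with the earlier
   stages and the maps F^i 1 -> F (F^k 1) for k < i. *)
Inductive node (F : set_functor) (X : SET) : Type :=
  Node (A : SET) (Y : A -> SET) (kids : forall a, node F (Y a))
    (p : forall a, X -> F (Y a)).

Fixpoint is_conn (F : set_functor) (Y : SET) (L : node F Y) {struct L} :
    forall X : SET, node F X -> (X -> Y) -> Prop :=
  match L with
  | Node A2 Y2 kids2 p2 => fun X K h => forall a : A2,
      match K with
      | Node A1 Y1 kids1 p1 => exists (b : A1) (h' : Y1 b -> Y2 a),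
          is_conn (kids2 a) (kids1 b) h' /\
          forall x, p2 a (h x) = fmap F h' (p1 b x)
      end
  end.

Definition limit_carrier (F : set_functor) (A : SET)
    (K : A -> {X : SET & node F X}) : SET :=
  {x : forall a, F (projT1 (K a)) |
    forall a b (h : projT1 (K a) -> projT1 (K b)),
      is_conn (projT2 (K b)) (projT2 (K a)) h -> fmap F h (x a) = x b}.

Fixpoint build (F : set_functor) (i : ord) : {X : SET & node F X} :=
  match i with
  | osup A f =>
    let K := fun a => build F (f a) in
    existT (node F) (limit_carrier K)
      (@Node F _ A (fun a => projT1 (K a)) (fun a => projT2 (K a))
         (fun a (x : limit_carrier K) => sval x a))
  end.

Lemma sval_funext (A : Type) (B : A -> Type) (P : (forall a, B a) -> Prop)
    (x y : {f | P f}) : (forall a, sval x a = sval y a) -> x = y.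
Proof.
case: x y => [f Pf] [g Pg] /= fg.
exact/eq_exist/functional_extensionality_dep.
Qed.

Section Existence.
Variable F : set_functor.
Notation X i := (projT1 (build F i)).
Notation Conn i j h := (is_conn (projT2 (build F j)) (projT2 (build F i)) h).

Lemma is_conn_osup (A B : SET) (f : A -> ord) (g : B -> ord)
    (h : X (osup g) -> X (osup f)) :
  Conn (osup g) (osup f) h <->
  forall a, exists b (h' : X (g b) -> X (f a)), Conn (g b) (f a) h' /\
    forall x, sval (h x) a = fmap F h' (sval x b).
Proof. by []. Qed.

Lemma is_conn_id i : Conn i i id.
Proof.
elim: i => A f IH; apply/is_conn_osup => a; exists a, id; split; first exact: IH.
by move=> x; rewrite fmap_id.
Qed.

Lemma is_conn_comp i j k (h : X i -> X j) (h' : X j -> X k) :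
  Conn i j h -> Conn j k h' -> Conn i k (h' \o h).
Proof.
elim: k i j h h' => C r IH [A f] [B g] h h' /is_conn_osup ij /is_conn_osup jk.
apply/is_conn_osup => c.
have [b [h1 [bc e1]]] := jk c; have [a [h2 [ab e2]]] := ij b.
exists a, (h1 \o h2); split; first exact: IH ab bc.
by move=> x; rewrite /= e1 e2 fmap_comp.
Qed.

Lemma is_conn_le i j (h : X i -> X j) : Conn i j h -> j <=o i.
Proof.
elim: j i h => B g IH [A f] h /is_conn_osup ij b.
by have [a [h' [ab _]]] := ij b; exists a; apply: IH ab.
Qed.

Lemma is_conn_exists_unique j :
  (forall i, i <=o j -> exists h : X j -> X i, Conn j i h) /\
  (forall i (h h' : X j -> X i), Conn j i h -> Conn j i h' -> h = h').
Proof.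
elim: j => B g IH.
have key k b b' (h : X (g b) -> X k) (h' : X (g b') -> X k) (x : X (osup g)) :
    Conn (g b) k h -> Conn (g b') k h' ->
    fmap F h (sval x b) = fmap F h' (sval x b').
  wlog bb' : b b' h h' / g b <=o g b' => [W|] ch ch'.
    have [bb'|/olt_le b'b] := ole_total (g b) (g b').
      exact: W bb' ch ch'.
    by apply/esym; apply: W b'b ch' ch.
  have [m cm] := (IH b').1 _ bb'.
  rewrite -(svalP x _ _ _ cm) -[LHS]/((fmap F h \o fmap F m) _) -fmap_comp.
  by rewrite ((IH b').2 _ _ _ (is_conn_comp cm ch) ch').
split=> [[A f] ij|[A f] h h' /is_conn_osup ch /is_conn_osup ch'].
  have /choice[b hb] a : exists b, f a <=o g b by exact: ij.
  pose m a := sval (cid ((IH (b a)).1 _ (hb a))).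
  have cm a : Conn (g (b a)) (f a) (m a) := svalP (cid ((IH (b a)).1 _ (hb a))).
  have compat (x : X (osup g)) a a' (h : X (f a) -> X (f a')) :
      Conn (f a) (f a') h ->
      fmap F h (fmap F (m a) (sval x (b a))) = fmap F (m a') (sval x (b a')).
    move=> ch; rewrite -[LHS]/((fmap F h \o fmap F (m a)) _) -fmap_comp.
    by apply: key => //; apply: is_conn_comp ch.
  exists (fun x => exist _ (fun a => fmap F (m a) (sval x (b a))) (compat x)).
  by apply/is_conn_osup => a; exists (b a), (m a).
apply: funext => x; apply: sval_funext => a.
have [b [k [ck e]]] := ch a; have [b' [k' [ck' e']]] := ch' a.
by rewrite e e'; apply: key.
Qed.

Definition build_conn i j (ji : j <=o i) : X i -> X j :=
  sval (cid ((is_conn_exists_unique i).1 j ji)).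

Lemma build_connP i j (ji : j <=o i) : Conn i j (build_conn ji).
Proof. exact: svalP (cid ((is_conn_exists_unique i).1 j ji)). Qed.

Lemma build_conn_uniq i j (ji : j <=o i) h : Conn i j h -> h = build_conn ji.
Proof. by move=> c; apply: (is_conn_exists_unique i).2 c (build_connP ji). Qed.

Lemma build_conn_refl i (h : i <=o i) : build_conn h = id.
Proof. by rewrite -(build_conn_uniq h (is_conn_id i)). Qed.

Lemma build_conn_trans i j k (ij : j <=o i) (jk : k <=o j) (ik : k <=o i) :
  build_conn jk \o build_conn ij = build_conn ik.
Proof.
exact/build_conn_uniq/(is_conn_comp (build_connP ij) (build_connP jk)).
Qed.

Lemma build_zero : exists x : X ozero, forall y, y = x.
Proof.
have c (a b : Empty_set) (h : X (match a with end) -> X (match b with end)) :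
  is_conn (projT2 (build F (match b with end)))
    (projT2 (build F (match a with end))) h ->
  fmap F h (match a return F (X (match a with end)) with end)
  = match b return F (X (match b with end)) with end by case: a h.
exists (exist _ (fun a : Empty_set => match a with end) c) => y.
by apply: sval_funext; case.
Qed.

Definition build_step i (x : X (osucc i)) : F (X i) := sval x tt.

Lemma build_step_iso i : bijective (@build_step i).
Proof.
have c (y : F (X i)) (a b : unit) (h : X i -> X i) :
    Conn i i h -> fmap F h y = y.
  move=> ch.
  by rewrite (build_conn_uniq (ole_refl i) ch) build_conn_refl fmap_id.
exists (fun y => exist _ (fun _ : unit => y) (c y)) => // x.
by apply: sval_funext; case.
Qed.

Lemma build_conn_succ i j (ji : j <=o i) (ji' : osucc j <=o osucc i) :
  @build_step j \o build_conn ji' = fmap F (build_conn ji) \o @build_step i.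
Proof.
apply: funext => x; have [[] [h [ch e]]] := build_connP ji' tt.
by rewrite /= /build_step e (build_conn_uniq ji ch).
Qed.

Lemma build_proj (B : SET) (g : B -> ord) b (h : osucc (g b) <=o osup g) x :
  build_step (build_conn h x) = sval x b.
Proof.
have [b' [k [ck e]]] := build_connP h tt.
by rewrite /build_step e; apply: svalP x _ _ _ ck.
Qed.

Lemma build_limit j : olimit j ->
  forall (B : SET) (q : forall i, i <o j -> B -> X i),
    (forall i i' (ij : i <o j) (i'j : i' <o j) (ii' : i' <=o i),
       build_conn ii' \o q i ij = q i' i'j) ->
    exists! u : B -> X j,
      forall i (ij : i <o j), build_conn (olt_le ij) \o u = q i ij.
Proof.
case: j => A f [_ lim] B q qc.
have sf a : osucc (f a) <o osup f by apply/lim/olt_osup.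
have compat z a b (h : X (f a) -> X (f b)) : Conn (f a) (f b) h ->
    fmap F h (build_step (q _ (sf a) z)) = build_step (q _ (sf b) z).
  move=> ch; have ba := is_conn_le ch.
  rewrite (build_conn_uniq ba ch) -(qc _ _ (sf a) (sf b) (ole_succ2 ba)).
  by rewrite -[RHS]/((build_step (i := f b) \o build_conn _) _) (build_conn_succ ba).
exists (fun z => exist _ (fun a => build_step (q _ (sf a) z)) (compat z)).
split=> [[C k] ij|u' u'q]; apply: funext => z /=.
  apply: sval_funext => c.
  set w := build_conn _ _.
  have [a [h [ch ->]]] : exists a (h : X (f a) -> X (k c)),
      Conn (f a) (k c) h /\ sval w c = fmap F h (build_step (q _ (sf a) z)).
    have [a [h [ch e]]] := build_connP (olt_le ij) c.
    by exists a, h; split=> //; rewrite /w e.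
  have ca := is_conn_le ch.
  have sc : osucc (k c) <=o osup k by apply/olt_succ/olt_osup.
  have scj : osucc (k c) <o osup f by apply: ole_lt_trans sc ij.
  rewrite (build_conn_uniq ca ch).
  rewrite -[LHS]/((fmap F _ \o @build_step _) _) -(build_conn_succ _ (ole_succ2 ca)) /=.
  rewrite -[build_conn _ _]/((build_conn _ \o q _ _) z) (qc _ _ _ scj).
  by rewrite -(qc _ _ ij scj sc) /= build_proj.
apply: sval_funext => a.
rewrite -[LHS]/(build_step (q _ (sf a) z)) -(u'q _ (sf a)) /=.
exact: build_proj.
Qed.

End Existence.

Definition the_terminal_chain (F : set_functor) : terminal_chain F :=
  TerminalChain (@build_conn_refl F) (@build_conn_trans F) (build_zero F)
    (@build_step_iso F) (@build_conn_succ F) (@build_limit F).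

(* Main.v *)
Require Import Defs.
From mathcomp Require Import all_boot.
From mathcomp Require Import boolp.

Set Implicit Arguments.
Unset Strict Implicit.
Unset Printing Implicit Defensive.

(**
  Joint monicity of the legs of F^omega 1 is preserved by F, so v_(omega+1,omega)
  is monic; since F preserves monics with nonempty domain, transfinite induction
  makes every v_(i,omega) monic.  If no stage beyond omega were a fixed point,
  choosing for each of them an element outside the image of the next stage and
  projecting it to F^omega 1 would inject the class of ordinals into the set
  F^omega 1.  Terminality of a fixed stage holds for every set functor: a
  coalgebra A has a unique cone of iterated unfoldings A -> F^i 1.
*)

(** * Ordinals up to [ole], and injective maps *)

Lemma ole_ozero i : ozero <=o i.
Proof. by case: i => A f []. Qed.

Lemma osucc_ole i j : osucc i <=o osucc j -> i <=o j.
Proof. by move=> /(_ tt)[]. Qed.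

Lemma olt_omega i : i <o omega -> exists n, osucc i <=o ofin n.
Proof. by case=> n ltin; exists n.+1; apply: ole_succ2. Qed.

Lemma ord_cases i :
  [\/ i <=o ozero, olimit i | exists2 k, i <=o osucc k & osucc k <=o i].
Proof.
have [i0|zi] := ole_total i ozero; first exact: Or31.
have [lim|] := EM (forall k, k <o i -> osucc k <o i); first by apply: Or32.
move=> /existsNP[k /not_implyP[ki nki]]; apply: Or33; exists k.
  by have [|/nki] := ole_total i (osucc k).
exact/olt_succ.
Qed.

(** An injection with nonempty domain has a retraction, and [F] preserves retractions; [a0] supplies
    the values outside the image. *)
Lemma fmap_inj (F : set_functor) (A B : SET) (f : A -> B) (a0 : A) :
  injective f -> injective (fmap F f).
Proof.
move=> f_inj.
have [g gf] : exists g : B -> A, cancel f g.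
  have /choice[g hg] b : exists a, (exists x, f x = b) -> f a = b.
    have [[a fa]|nb] := EM (exists x, f x = b); first by exists a.
    by exists a0 => /nb.
  by exists g => a; apply: f_inj; apply: hg; exists a.
apply: (@can_inj _ _ _ (fmap F g)) => x.
rewrite -[LHS]/((fmap F g \o fmap F f) x) -fmap_comp.
by rewrite (_ : g \o f = id) ?fmap_id //; apply: funext.
Qed.

Lemma injective_monic (A B : SET) (f : A -> B) : injective f -> monic f.
Proof.
move=> f_inj C g h gh; apply: funext => c; apply: f_inj.
exact: (congr1 (fun u => u c) gh).
Qed.

Lemma inj_surj_bij (A B : Type) (f : A -> B) :
  injective f -> (forall y, exists x, f x = y) -> bijective f.
Proof.
move=> f_inj /choice[g fg]; exists g => // x.
by apply: f_inj; rewrite fg.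
Qed.

(** * Points of the stages and their projections *)

Section Chain.
Variables (F : set_functor) (V : terminal_chain F).

Lemma connE i j k (ij : j <=o i) (jk : k <=o j) (ik : k <=o i) x :
  conn V jk (conn V ij x) = conn V ik x.
Proof. by rewrite -(conn_trans V ij jk ik). Qed.

Lemma connK i j (ij : j <=o i) (ji : i <=o j) :
  cancel (conn V ij) (conn V ji).
Proof. by move=> x; rewrite (connE _ _ (ole_refl i)) conn_refl. Qed.

Lemma conn_succE i j (ji : j <=o i) (ji' : osucc j <=o osucc i) x :
  chain_step (conn V ji' x) = fmap F (conn V ji) (chain_step x).
Proof. exact: (congr1 (fun u => u x) (conn_succ V ji ji')). Qed.

Lemma chain_step_inj i : injective (@chain_step F V i).
Proof. exact/bij_inj/chain_step_iso. Qed.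

Lemma stage_zero_eq i (i0 : i <=o ozero) (x y : V i) : x = y.
Proof.
rewrite -(connK (ole_ozero i) i0 x) -(connK (ole_ozero i) i0 y).
by have [z eqz] := stage_zero V; rewrite (eqz (conn V _ x)) (eqz (conn V _ y)).
Qed.

(** At zero the stage is a singleton; at a limit, [x] and [y] are mediating maps from [unit] for the
    same cone; a successor is itself one of the indices tested. *)
Lemma stage_ext i (x y : V i) :
  (forall k (ki : osucc k <=o i), conn V ki x = conn V ki y) -> x = y.
Proof.
move=> xy; case: (ord_cases i) => [i0|lim|[k ik ki]]; first exact: stage_zero_eq.
  have cc k k' (ki : k <o i) (k'i : k' <o i) (kk' : k' <=o k) :
      conn V kk' \o (fun _ : unit => conn V (olt_le ki) x)
      = fun=> conn V (olt_le k'i) x by apply: funext => _ /=; apply: connE.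
  have [u [_ uniq_u]] := stage_limit lim cc.
  have ux : u = fun=> x by apply: uniq_u.
  have uy : u = fun=> y.
    apply: uniq_u => k ki; apply: funext => _ /=.
    (* Agreement is known only at successors, so the projection to [k] is routed through
       [osucc k]. *)
    have ski : osucc k <=o i by apply/olt_succ.
    by rewrite -!(connE ski (ole_osucc k)) xy.
  exact: (congr1 (fun v => v tt) (etrans (esym ux) uy)).
by rewrite -(connK ki ik x) -(connK ki ik y) xy.
Qed.

(** * Unfolding a coalgebra along the chain, and terminality *)

Section Unfolding.
Variables (A : SET) (a : A -> F A).

(* The canonical cone A -> F^i 1, as a predicate rather than a recursive
   function because the zero/successor/limit cases hold only up to [ole]. *)
Inductive unfolding (i : ord) (h : A -> V i) : Prop :=
  Unfolding of forall k (ki : osucc k <=o i), exists h' : A -> V k,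
    unfolding h' /\ @chain_step F V k \o (conn V ki \o h) = fmap F h' \o a.

(** By [stage_ext] only the components at successors [osucc k] matter; each is computed from an
    unfolding at [k], unique by induction. *)
Lemma unfolding_uniq i (h h' : A -> V i) : unfolding h -> unfolding h' -> h = h'.
Proof.
elim/(well_founded_ind olt_wf): i => i IH in h h' *.
move=> [uh] [uh']; apply: funext => x; apply: stage_ext => k ki.
apply: chain_step_inj.
have [g [ug eg]] := uh k ki; have [g' [ug' eg']] := uh' k ki.
have gg' : g = g' by apply: IH => //; apply/olt_succ.
rewrite -gg' -eg in eg'; exact: (congr1 (fun u => u x) (esym eg')).
Qed.

Lemma unfolding_conn i j (ij : j <=o i) (h : A -> V i) :
  unfolding h -> unfolding (conn V ij \o h).
Proof.
move=> [uh]; constructor=> k kj.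
have [g [ug eg]] := uh k (ole_trans kj ij).
by exists g; split=> //; rewrite -eg -(conn_trans V ij kj (ole_trans kj ij)).
Qed.

Lemma unfolding_succ k (h : A -> V (osucc k)) (h' : A -> V k) :
  unfolding h -> unfolding h' -> @chain_step F V k \o h = fmap F h' \o a.
Proof.
move=> [uh] uh'; have [g [ug eg]] := uh k (ole_refl _).
by rewrite (unfolding_uniq uh' ug) -eg conn_refl.
Qed.

(** A constant map serves at zero and the mediating map of the earlier unfoldings at a limit; at a
    successor, [fmap F g \o a] is transported back along [chain_step]. *)
Lemma unfolding_exists i : exists h : A -> V i, unfolding h.
Proof.
elim/(well_founded_ind olt_wf): i => i IH.
case: (ord_cases i) => [i0|lim|[k ik ki]].
- have [z _] := stage_zero V; exists (fun=> conn V i0 z).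
  by constructor=> k ki; case: (ole_trans ki i0 tt).
- pose p k (ki : k <o i) : A -> V k := sval (cid (IH k ki)).
  have up k ki : unfolding (p k ki) := svalP (cid (IH k ki)).
  have pp k k' (ki : k <o i) (k'i : k' <o i) (kk' : k' <=o k) :
      conn V kk' \o p k ki = p k' k'i.
    exact/unfolding_uniq/up/unfolding_conn.
  have [u [pu _]] := stage_limit lim pp.
  exists u; constructor=> k ki.
  have ki' : k <o i by apply/olt_succ.
  exists (p k ki'); split=> //.
  rewrite -(unfolding_succ (up _ (lim.2 _ ki')) (up k ki')) -pu.
  congr (_ \o _); apply: funext => x /=.
  by rewrite (Prop_irrelevance ki (olt_le (lim.2 k ki'))).
have ki' : k <o i by apply/olt_succ.
have [g ug] := IH k ki'; have [s _ sK] := chain_step_iso V k.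
exists (fun x => conn V ik (s (fmap F g (a x)))); constructor=> m mi.
have mk : m <=o k by apply/osucc_ole/(ole_trans mi ik).
exists (conn V mk \o g); split; first exact: unfolding_conn.
apply: funext => x /=.
by rewrite (connE _ _ (ole_succ2 mk)) (conn_succE mk) sK fmap_comp.
Qed.

End Unfolding.

(** The unfolding at [d] is the projection of the one at [osucc d], which makes it a homomorphism.
    Conversely, any homomorphism projects to unfoldings at all stages up to [d], hence is unique. *)
Lemma fixed_stage_terminal d (vinv : V d -> V (osucc d)) :
  cancel (conn V (ole_osucc d)) vinv -> cancel vinv (conn V (ole_osucc d)) ->
  is_terminal_coalgebra (fun x => chain_step (vinv x)).
Proof.
move=> vK vinvK A a.
have [h uh] := unfolding_exists a d; have [h1 uh1] := unfolding_exists a (osucc d).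
exists h; split.
  rewrite -(unfolding_succ uh1 uh).
  rewrite (unfolding_uniq uh (unfolding_conn (ole_osucc d) uh1)).
  by apply: funext => x /=; rewrite vK.
move=> g hom_g; suff ug i (di : i <=o d) : unfolding a (conn V di \o g).
  by rewrite (unfolding_uniq uh (ug d (ole_refl d))) conn_refl.
elim/(well_founded_ind olt_wf): i => i IH in di *.
constructor=> k ki; have ki' : k <o i by apply/olt_succ.
have kd : k <=o d by apply: ole_trans (olt_le ki') di.
exists (conn V kd \o g); split; first exact: IH.
rewrite fmap_comp -compA -hom_g; apply: funext => x /=.
(* Through [vinvK], both sides become projections of [vinv (g x)] to stage [osucc k]. *)
rewrite -(conn_succE kd (ole_succ2 kd)) -{1}(vinvK (g x)).
by rewrite (connE _ _ (ole_trans di (ole_osucc d))) (connE _ _ (ole_succ2 kd)).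
Qed.

(** * Injectivity over omega, and convergence *)

Hypothesis HF : precontinuous F.

Lemma conn_omega_succ_inj : injective (conn V (ole_osucc omega)).
Proof.
pose D := @OpChain (fun n => V (ofin n)) (fun n => conn V (ole_osucc (ofin n))).
have fin_le n : ofin n <=o omega := ole_osup ofin n.
have comm n : chain_map D n \o conn V (fin_le n.+1) = conn V (fin_le n).
  exact: conn_trans.
pose K : cone D := Cone comm.
have Kpre : is_prelimit K.
  move=> K' h h' hK h'K; apply: funext => c; apply: stage_ext => k ki.
  have /olt_succ/olt_omega[n kn] := ki.
  rewrite -!(connE (fin_le n) kn); congr (conn V kn _).
  exact: (congr1 (fun u => u c) (etrans (hK n) (esym (h'K n)))).
(* The projection of [x] witnesses that the apex is nonempty. *)
move=> x y xy; have FKpre : is_prelimit (map_cone F K).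
  by apply: HF Kpre; exists; apply: conn (ole_osucc omega) x.
have legE n : fmap F (conn V (fin_le n)) (chain_step x)
            = fmap F (conn V (fin_le n)) (chain_step y).
  rewrite -!(conn_succE _ (ole_succ2 (fin_le n))); congr chain_step.
  by rewrite -!(connE (ole_osucc omega) (fin_le n.+1)) xy.
have Kc n : chain_map (map_opchain F D) n \o
    (fun _ : unit => fmap F (conn V (fin_le n.+1)) (chain_step x))
    = fun=> fmap F (conn V (fin_le n)) (chain_step x).
  by apply: funext => -[]; rewrite -(map_leg_comm F K n).
apply: chain_step_inj.
(* The two points are factorizations of one cone with apex [unit]. *)
have := FKpre (Cone Kc) (fun=> chain_step x) (fun=> chain_step y).
move=> /(_ _ _)/(congr1 (fun u => u tt)); by apply=> n; apply: funext => _ /=.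
Qed.

Lemma conn_omega_inj i (wi : omega <=o i) : injective (conn V wi).
Proof.
elim/(well_founded_ind olt_wf): i => i IH in wi * => x y xy.
(* Otherwise [osucc k], and with it [i], would lie below a finite ordinal. *)
have ge_omega k : i <=o osucc k -> omega <=o k.
  move=> ik; have [//|kw] := ole_total omega k.
  have [n kn] := olt_omega kw; case: (@olt_irr (ofin n)).
  by apply: olt_le_trans (ole_trans wi (ole_trans ik kn)); apply: olt_osup.
case: (ord_cases i) => [i0|lim|[k ik ki]]; first exact: stage_zero_eq.
  apply: stage_ext => k ki; have ki' := lim.2 _ ((olt_succ _ _).2 ki).
  have [wk|kw] := ole_total omega (osucc k).
    by apply: (IH _ ki' wk); rewrite !(connE ki wk wi).
  by rewrite -!(connE wi (olt_le kw)) xy.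
have wk := ge_omega k ik; have ki' : k <o i by apply/olt_succ.
rewrite -(connK ki ik x) -(connK ki ik y); congr (conn V ik _).
(* Up to [chain_step], v_(k+1,omega+1) is F v_(k,omega), hence injective; it remains to descend from
   omega+1 to omega. *)
apply: chain_step_inj; apply: (fmap_inj (conn V (olt_le ki') x) (IH k ki' wk)).
rewrite -!(conn_succE wk (ole_succ2 wk)); congr chain_step.
apply: conn_omega_succ_inj.
by rewrite !(connE ki _ (ole_trans (ole_succ2 wk) ki)) !(connE _ _ wi).
Qed.

Lemma converges_beyond_omega : exists2 d, omega <=o d & converges_in V d.
Proof.
apply: contrapT => nconv.
(* [v] is the trace at omega of a point of stage [i] missed by the next stage. *)
pose new (v : V omega) i := exists wi : omega <=o i,
  exists2 x : V i, conn V wi x = v & forall y, conn V (ole_osucc i) y <> x.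
have new_ex i (wi : omega <=o i) : exists v, new v i.
  have [surj|/existsNP[x nx]] := EM (forall x, exists y, conn V (ole_osucc i) y = x).
    case: nconv; exists i => //; apply: inj_surj_bij surj => x y xy.
    have wsi := ole_trans wi (ole_osucc i).
    by apply: (@conn_omega_inj _ wsi); rewrite -!(connE (ole_osucc i) wi) xy.
  by exists (conn V wi x), wi, x => // y yx; apply: nx; exists y.
(* If j < i, then [x] projects to [y] at stage [j], as both lie over [v]; so [y] would be hit from
   stage [osucc j]. *)
have new_le v i j : new v i -> new v j -> i <=o j.
  move=> [wi [x xv nx]] [wj [y yv ny]]; have [//|ji] := ole_total i j.
  have sji : osucc j <=o i by apply/olt_succ.
  case: (ny (conn V sji x)); apply: (@conn_omega_inj _ wj).
  by rewrite (connE _ _ (olt_le ji)) (connE _ _ wi) xv yv.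
have /choice[g hg] v : exists i, forall j, new v j -> j <=o i.
  have [[i vi]|nv] := EM (exists i, new v i).
    by exists i => j vj; apply: new_le vi.
  by exists ozero => j vj; case: nv; exists j.
(* [d] lies above omega (by [None]) and above every [g v]; a [v] new at [d] then gives d <= g v <
   d. *)
pose d := osup (fun o : option (V omega) => oapp g omega o).
have wd : omega <=o d by apply/olt_le; exists None; apply: ole_refl.
have [v vd] := new_ex d wd; apply: (@olt_irr d).
by exists (Some v); apply: hg.
Qed.

End Chain.

Theorem theorem4p5 (F : set_functor) (HF : precontinuous F)
    (V : terminal_chain F) :
  exists (delta : ord) (omega_le : ole omega delta),
    converges_in V delta /\
    (forall vinv : V delta -> V (osucc delta),
       cancel (conn V (ole_osucc delta)) vinv ->
       cancel vinv (conn V (ole_osucc delta)) ->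
       is_terminal_coalgebra (fun x => chain_step (vinv x))) /\
    monic (conn V omega_le).
Proof.
have [d wd conv] := converges_beyond_omega V HF.
exists d, wd; split=> //; split; first exact: fixed_stage_terminal.
exact/injective_monic/conn_omega_inj.
Qed.
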